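(* Let $D\subset\mathbb{R}^d$ be a compact set whose convex hull contains the origin in its interior, let $\epsilon_0\in(0,1)$, and fix admissible training data $x_{-n_0+1},\dots,x_0\in\mathbb{R}^d$ for $(D,\epsilon_0)$. For a path $\xi=x_1x_2\cdots\in D^\infty$ put $s_N=x_1+\dots+x_N$ and $V_N=\sum_{n=1}^N x_nx_n^{\mathrm t}$, so that $\operatorname{tr}V_N=\sum_{n=1}^N\|x_n\|^2$. Then by the sequential optimizing strategy Skeptic can weakly force the event $$E:\quad \limsup_{N\to\infty}\frac{\|s_N\|}{\sqrt{\max\bigl(1,\ \operatorname{tr}V_N\,\log(\operatorname{tr}V_N)\bigr)}}<\infty .$$ That is, for every path $\xi\in D^\infty$ for which this limsup is infinite, the capital process $\mathcal{K}^*_{1,N}$ of the sequential optimizing strategy satisfies $\limsup_{N\to\infty}\mathcal{K}^*_{1,N}=\infty$.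
   Context: Bounded forecasting game: Skeptic starts with capital $\mathcal K_0=1$; in each round $n=1,2,\dots$ Skeptic announces $\alpha_n\in\mathbb{R}^d$ (depending only on $x_1,\dots,x_{n-1}$), then Reality announces $x_n\in D$, and $\mathcal K_n=\mathcal K_{n-1}(1+\alpha_n\cdot x_n)$. Vectors are columns, $\|\cdot\|$ is the Euclidean norm, $^{\mathrm t}$ is transpose. Admissible training data: a finite list $x_{-n_0+1},\dots,x_0\in\mathbb{R}^d$ ($n_0\ge d+1$), chosen in advance by Skeptic, such that for every $\alpha\in\mathbb{R}^d$: if $1+\alpha\cdot x_n\ge 0$ for all $n=-n_0+1,\dots,0$, then $1+\alpha\cdot x\ge\epsilon_0$ for all $x\in D$. (This implies that the training vectors span $\mathbb{R}^d$.) For $N\ge0$ let $\Phi_{0,N}(\alpha)=\sum_{n=-n_0+1}^N\log(1+\alpha\cdot x_n)$. It has a unique maximizer $\alpha_N^*$, which lies in the interior of $\{\alpha: 1+\alpha\cdot x_n\ge0,\ n=-n_0+1,\dots,0\}$. The sequential optimizing strategy is $\alpha_n=\alpha_{n-1}^*$, $n\ge1$, with capital process $\mathcal K^*_{1,N}=\prod_{n=1}^N(1+\alpha_{n-1}^*\cdot x_n)$. Skeptic weakly forces an event $E\subset D^\infty$ by a strategy if the limsup of the capital process of that strategy is $+\infty$ for every $\xi\notin E$. Convention: $0\log0=0$. *)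

(* Defs.v *)
From HB Require Import structures.
From mathcomp Require Import all_boot all_order all_algebra.
From mathcomp Require Import all_classical all_reals all_analysis.

Set Implicit Arguments.
Unset Strict Implicit.
Unset Printing Implicit Defensive.

Import Order.TTheory GRing.Theory Num.Theory.
Import numFieldNormedType.Exports.

Local Open Scope classical_set_scope.
Local Open Scope ring_scope.

Section Euclidean.
Variables (R : realType) (d : nat).
Implicit Types a x : 'cV[R]_d.

Definition dotv a x : R := \sum_(i < d) a i 0 * x i 0.

(* The library norm on matrices is the sup norm. *)
Definition enorm x : R := Num.sqrt (dotv x x).

Definition convex_hull (D : set 'cV[R]_d) : set 'cV[R]_d :=
  smallest (@convex_set R 'cV[R]_d) D.

End Euclidean.

(* A path x_1 x_2 ... is a function xi : nat -> 'cV[R]_d with x_n = xi n.-1;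
   mkseq xi n is thus the list [:: x_1; ...; x_n]. *)
Section Game.
Variables (R : realType) (d : nat).
Implicit Types (D : set 'cV[R]_d) (xi : nat -> 'cV[R]_d) (s : seq 'cV[R]_d).

(* A strategy maps the past moves [:: x_1; ...; x_(n-1)] to alpha_n. *)
Definition strategy := seq 'cV[R]_d -> 'cV[R]_d.

Definition capital (S : strategy) xi (N : nat) : R :=
  \prod_(n < N) (1 + dotv (S (mkseq xi n)) (xi n)).

Definition weakly_forces D (S : strategy) (E : set (nat -> 'cV[R]_d)) : Prop :=
  forall xi, (forall n, D (xi n)) -> ~ E xi ->
    limn_esup (fun N => (capital S xi N)%:E) = +oo%E.

Definition admissible_training D (eps0 : R) s : Prop :=
  (d + 1 <= size s)%N /\
  forall a : 'cV[R]_d,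
    (forall x, x \in s -> 0 <= 1 + dotv a x) ->
    forall x, D x -> eps0 <= 1 + dotv a x.

(* Since ln is 0 on nonpositive reals, Phi is only meaningful on Phi_dom,
   outside of which the log-sum is undefined or -oo. *)
Definition Phi s (a : 'cV[R]_d) : R := \sum_(x <- s) ln (1 + dotv a x).

Definition Phi_dom s : set 'cV[R]_d :=
  [set a | forall x, x \in s -> 0 < 1 + dotv a x].

Definition is_Phi_max s (a : 'cV[R]_d) : Prop :=
  Phi_dom s a /\ forall b, Phi_dom s b -> Phi s b <= Phi s a.

(* The default value 0 is only used when Phi has no maximizer, which does not
   happen for admissible training data followed by moves in D. *)
Definition sos (training : seq 'cV[R]_d) : strategy :=
  fun past => xget 0 [set a | is_Phi_max (training ++ past) a].

Definition psum xi (N : nat) : 'cV[R]_d := \sum_(n < N) xi n.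

Definition Vmx xi (N : nat) : 'M[R]_d := \sum_(n < N) xi n *m (xi n)^T.

(* The convention 0 log 0 = 0 holds here as ln 0 = 0. *)
Definition growth_event : set (nat -> 'cV[R]_d) :=
  [set xi | (limn_esup (fun N =>
     (enorm (psum xi N) /
      Num.sqrt (Num.max 1 (\tr (Vmx xi N) * ln (\tr (Vmx xi N)))))%:E)
     < +oo)%E].

End Game.

(* Main.v *)
(* Write Phi_n for the log-likelihood of the training data and x_1, ..., x_n, let
   a_n be its maximizer and W_n the corresponding sum of the x x^T. As Phi_n
   increases by ln (1 + a_n . x_{n+1}) at the fixed point a_n,
     ln K_n = Phi_n a_n - Phi_0 a_0 - sum_(k < n) (Phi_{k+1} a_{k+1} - Phi_{k+1} a_k).
   The admissible region is bounded, hence Phi is uniformly concave with respect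
   to the quadratic form W, and each term of the sum is O(ln (1 + q)) with
   q = x^T W_k^-1 x. Since det W_{k+1} = det W_k * (1 + q), the sum telescopes
   to O(ln det W_n) = O(ln tr V_n). On the other hand, evaluating Phi_n at
   mu s_n / |s_n| gives Phi_n a_n >= mu |s_n| - 2 mu^2 tr V_n - O(1) for all small
   mu. If K_n is bounded, optimizing mu yields |s_n| = O(sqrt (tr V_n ln tr V_n)). *)

Require Import Defs.
From HB Require Import structures.
From mathcomp Require Import all_boot all_order all_algebra.
From mathcomp Require Import all_classical all_reals all_analysis.
From mathcomp Require Import ring lra.

Set Implicit Arguments.
Unset Strict Implicit.
Unset Printing Implicit Defensive.

Import Order.TTheory GRing.Theory Num.Theory.
Import numFieldNormedType.Exports.

Local Open Scope classical_set_scope.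
Local Open Scope ring_scope.

(** * Quantitative concavity of the logarithm *)

Section LnInequalities.
Variable R : realType.
Implicit Types C u v x y : R.

(** This is [ln (1 + z) <= z] taken at [1 + z = (1 + y)^-1]. *)
Lemma ln_ge_divD1 y : -1 < y -> y / (1 + y) <= ln (1 + y).
Proof.
move=> y1; have p : 0 < 1 + y by lra.
have := @le_ln1Dx R ((1 + y)^-1 - 1); rewrite ltrBrDl addrN invr_gt0 => /(_ p).
rewrite addrC subrK lnV ?posrE// => h.
suff -> : y / (1 + y) = 1 - (1 + y)^-1 by lra.
by field; rewrite gt_eqF.
Qed.

(** The difference of [y / (1 + y)] and the left side is [y ^+ 2 * (1 + 2 * y) / (1 + y)],
    nonnegative in this range. *)
Lemma ln_ge_sub_sqr y : `|y| <= 2^-1 -> y - 2 * y ^+ 2 <= ln (1 + y).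
Proof.
rewrite ler_norml => /andP[y1 y2].
have p : 0 < 1 + y by lra.
apply: le_trans (ln_ge_divD1 _); last by lra.
by rewrite ler_pdivlMr//; nra.
Qed.

(** For the [y] of the proof, [1 + y] is the squared arithmetic mean over [u * v], so [ln (1 + y)]
    is twice the concavity defect at the midpoint. It is bounded below by [y / (1 + y)], which is at
    least [(v - u) ^+ 2 / (4 * C ^+ 2)]. *)
Lemma ln_midpoint C u v : 0 < u <= C -> 0 < v <= C ->
  (ln u + ln v) / 2 + (v - u) ^+ 2 / (8 * C ^+ 2) <= ln ((u + v) / 2).
Proof.
move=> /andP[u0 uC] /andP[v0 vC]; have C0 : 0 < C by lra.
have m0 : 0 < (u + v) / 2 by lra.
pose y := (v - u) ^+ 2 / (4 * u * v).
have uv0 : 0 < 4 * u * v by rewrite !mulr_gt0.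
have y0 : 0 <= y by rewrite divr_ge0 ?sqr_ge0// ltW.
have lny : ln (1 + y) = 2 * ln ((u + v) / 2) - (ln u + ln v).
  rewrite -lnM ?posrE// mulr_natl -lnXn// -ln_div ?posrE.
  - by congr ln; rewrite /y; field; rewrite !gt_eqF.
  - exact: exprn_gt0.
  - exact: mulr_gt0.
have := @ln_ge_divD1 y (lt_le_trans (ltrN10 R) y0); rewrite lny.
have -> : y / (1 + y) = (v - u) ^+ 2 / (u + v) ^+ 2.
  by rewrite /y; field; rewrite !gt_eqF//; nra.
have : (v - u) ^+ 2 / (4 * C ^+ 2) <= (v - u) ^+ 2 / (u + v) ^+ 2.
  apply: ler_wpM2l; first exact: sqr_ge0.
  by rewrite lef_pV2 ?posrE; nra.
have -> : (v - u) ^+ 2 / (4 * C ^+ 2) = 2 * ((v - u) ^+ 2 / (8 * C ^+ 2)).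
  by field; rewrite gt_eqF.
lra.
Qed.

(** With m the midpoint, [ln_midpoint] bounds [ln v] by 2 ln m - [ln u] minus the square term, and
    ln (m / u) is at most [(v - u) / (2 * u)]. *)
Lemma ln_le_tangent C u v : 0 < u <= C -> 0 < v <= C ->
  ln v <= ln u + (v - u) / u - (v - u) ^+ 2 / (4 * C ^+ 2).
Proof.
move=> uC vC; have := ln_midpoint uC vC.
move: uC vC => /andP[u0 uC] /andP[v0 vC]; have C0 : 0 < C by lra.
have := @le_ln1Dx R ((v - u) / (2 * u)).
have -> : 1 + (v - u) / (2 * u) = (u + v) / 2 / u by field; rewrite gt_eqF.
rewrite ln_div ?posrE//; last by lra.
have -> : (v - u) / u = 2 * ((v - u) / (2 * u)) by field; rewrite gt_eqF.
have -> : (v - u) ^+ 2 / (4 * C ^+ 2) = 2 * ((v - u) ^+ 2 / (8 * C ^+ 2)).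
  by field; rewrite gt_eqF.
have h : -1 < (v - u) / (2 * u) by rewrite ltr_pdivlMr; lra.
move=> /(_ h); lra.
Qed.

End LnInequalities.

(** * Inner products, Gram matrices and rank-one updates of the determinant *)

Section Quadratic.
Variables (R : realType) (d : nat).
Implicit Types (a b x : 'cV[R]_d) (s : seq 'cV[R]_d).

Lemma dotvE a x : dotv a x = (a^T *m x) 0 0.
Proof. by rewrite !mxE; apply: eq_bigr => i _; rewrite mxE. Qed.

Lemma dotvC a x : dotv a x = dotv x a.
Proof. by apply: eq_bigr => i _; rewrite mulrC. Qed.

Lemma dotvDl a b x : dotv (a + b) x = dotv a x + dotv b x.
Proof. by rewrite !dotvE linearD mulmxDl mxE. Qed.

Lemma dotvZl k a x : dotv (k *: a) x = k * dotv a x.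
Proof. by rewrite !dotvE linearZ/= -scalemxAl mxE. Qed.

Lemma dotvBl a b x : dotv (a - b) x = dotv a x - dotv b x.
Proof. by rewrite dotvDl -scaleN1r dotvZl mulN1r. Qed.

Lemma dotvBr a b x : dotv x (a - b) = dotv x a - dotv x b.
Proof. by rewrite dotvC dotvBl (dotvC a) (dotvC b). Qed.

Lemma dotvZr k a x : dotv x (k *: a) = k * dotv x a.
Proof. by rewrite dotvC dotvZl (dotvC a). Qed.

Lemma dotv0l x : dotv 0 x = 0.
Proof. by rewrite dotvE trmx0 mul0mx mxE. Qed.

Lemma dotv_sumr a n (f : 'I_n -> 'cV[R]_d) :
  dotv a (\sum_(i < n) f i) = \sum_(i < n) dotv a (f i).
Proof. by rewrite dotvE mulmx_sumr summxE; apply: eq_bigr => i _; rewrite dotvE. Qed.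

Lemma dotvv_ge0 x : 0 <= dotv x x.
Proof. by apply: sumr_ge0 => i _; rewrite -expr2 sqr_ge0. Qed.

Lemma sqr_enorm x : enorm x ^+ 2 = dotv x x.
Proof. by rewrite sqr_sqrtr// dotvv_ge0. Qed.

Lemma enorm_ge0 x : 0 <= enorm x.
Proof. exact: sqrtr_ge0. Qed.

Lemma sqr_dotv_le a x : dotv a x ^+ 2 <= dotv a a * dotv x x.
Proof.
have [x0|x0] := eqVneq (dotv x x) 0.
  suff -> : x = 0 by rewrite dotvC !dotv0l expr0n mulr0.
  apply/matrixP => i j; rewrite ord1 mxE; apply/eqP; rewrite -sqrf_eq0 expr2.
  move/eqP: x0; rewrite psumr_eq0; last by move=> k _; rewrite -expr2 sqr_ge0.
  by move=> /allP/(_ i); rewrite mem_index_enum => /(_ isT).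
have xp : 0 < dotv x x by rewrite lt_neqAle eq_sym x0 dotvv_ge0.
(* The residual of [a] after projection onto [x] has nonnegative squared norm. *)
have := dotvv_ge0 (a - (dotv a x / dotv x x) *: x).
rewrite !(dotvBl, dotvBr) !(dotvZl, dotvZr) (dotvC x a).
set p := dotv a x; set q := dotv x x in x0 xp *; set r := dotv a a.
have -> : r - p / q * p - (p / q * p - p / q * (p / q * q)) = (r * q - p ^+ 2) / q by field.
by rewrite pmulr_lge0 ?invr_gt0// subr_ge0.
Qed.

Definition gram s : 'M[R]_d := \sum_(x <- s) x *m x^T.
Definition qform s a : R := \sum_(x <- s) dotv a x ^+ 2.

Lemma gram_rcons s x : gram (rcons s x) = gram s + x *m x^T.
Proof. by rewrite /gram -cats1 big_cat big_seq1. Qed.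

Lemma qform_rcons s x a : qform (rcons s x) a = qform s a + dotv a x ^+ 2.
Proof. by rewrite /qform -cats1 big_cat big_seq1. Qed.

Lemma Phi_rcons s x a : Phi (rcons s x) a = Phi s a + ln (1 + dotv a x).
Proof. by rewrite /Phi -cats1 big_cat big_seq1. Qed.

Lemma dotv_gram s a b : dotv a (gram s *m b) = \sum_(x <- s) dotv a x * dotv b x.
Proof.
rewrite dotvE /gram mulmx_suml mulmx_sumr summxE; apply: eq_bigr => x _.
rewrite mulmxA [_ *m (x *m _)]mulmxA -mulmxA mxE big_ord1 -!dotvE.
by rewrite (dotvC b).
Qed.

Lemma qformE s a : qform s a = dotv a (gram s *m a).
Proof. by rewrite dotv_gram; apply: eq_bigr => x _; rewrite expr2. Qed.

Lemma qform_ge0 s a : 0 <= qform s a.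
Proof. by apply: sumr_ge0 => x _; rewrite sqr_ge0. Qed.

Lemma qformB s a b :
  qform s (a - b) = qform s a - 2 * dotv a (gram s *m b) + qform s b.
Proof.
rewrite dotv_gram /qform mulr_sumr -sumrB -big_split/=; apply: eq_bigr => x _.
by rewrite dotvBl; ring.
Qed.

Lemma qformZ s k a : qform s (k *: a) = k ^+ 2 * qform s a.
Proof.
by rewrite /qform mulr_sumr; apply: eq_bigr => x _; rewrite dotvZl exprMn.
Qed.

Lemma det_rank1_update (W : 'M[R]_d) x : W \in unitmx ->
  \det (W + x *m x^T) = \det W * (1 + dotv (invmx W *m x) x).
Proof.
move=> Wu.
have -> : W + x *m x^T = W *m (1%:M + (invmx W *m x) *m x^T).
  by rewrite mulmxDr mulmx1 !mulmxA mulmxV// mul1mx.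
rewrite det_mulmx; congr (_ * _); set v := invmx W *m x.
(* Factoring one bordered matrix as lower times upper and as upper times lower gives det (I + v x^T)
   = 1 + x^T v. *)
have e1 : block_mx 1%:M (- x^T) v 1%:M =
    block_mx 1%:M 0 v 1%:M *m block_mx 1%:M (- x^T) 0 (1%:M + v *m x^T).
  by rewrite mulmx_block !mul1mx !mulmx1 !mul0mx !addr0 mulmxN addrC addrK.
have e2 : block_mx 1%:M (- x^T) v 1%:M =
    block_mx 1%:M (- x^T) 0 1%:M *m block_mx (1%:M + x^T *m v) 0 v 1%:M.
  by rewrite mulmx_block !mul1mx !mulmx1 !mul0mx !add0r mulNmx addrK.
have := congr1 determinant e1; rewrite {1}e2 !det_mulmx.
rewrite !(@det_ublock _ 1) !(@det_lblock _ 1) !det1 !mul1r !mulr1 => <-.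
by rewrite det_mx11 !mxE dotvC dotvE mxE.
Qed.

End Quadratic.

(** * Regret of a single round and growth of the determinant *)

Section Regret.
Variables (R : realType) (d : nat).
Implicit Types (a b x : 'cV[R]_d) (s : seq 'cV[R]_d) (C e k : R).

Lemma dotv_invmx_gram_ge0 s x : gram s \in unitmx ->
  0 <= dotv (invmx (gram s) *m x) x.
Proof.
move=> Wu; have := qform_ge0 s (invmx (gram s) *m x).
by rewrite qformE mulmxA mulmxV// mul1mx.
Qed.

Lemma gram_rcons_unit s x : gram s \in unitmx -> gram (rcons s x) \in unitmx.
Proof.
move=> Wu; rewrite gram_rcons unitmxE det_rank1_update// unitrM -unitmxE Wu/=.
by rewrite unitfE gt_eqF// ltr_pwDl// dotv_invmx_gram_ge0.
Qed.

(* With q = x^T (gram s)^-1 x, the left side is maximal at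
   delta = c / (2 k (1 + q)) (gram s)^-1 x, where it equals
   c^2 / (4 k) * q / (1 + q); moreover q / (1 + q) <= ln (1 + q), which is the
   increment of ln |det|. *)
Lemma quadratic_le_det_increment s x (delta : 'cV[R]_d) (c k : R) :
  0 < k -> gram s \in unitmx ->
  c * dotv delta x - k * qform (rcons s x) delta <=
  c ^+ 2 / (4 * k) *
    (ln `|\det (gram (rcons s x))| - ln `|\det (gram s)|).
Proof.
move=> k0 Wu; have q0 := dotv_invmx_gram_ge0 x Wu.
rewrite gram_rcons det_rank1_update// qform_rcons.
set v := invmx (gram s) *m x in q0 *; set q := dotv v x in q0 *.
have Wv : gram s *m v = x by rewrite mulmxA mulmxV// mul1mx.
have W0 : 0 < `|\det (gram s)| by rewrite normr_gt0 -unitfE -unitmxE.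
have q1 : 0 < 1 + q by lra.
rewrite normrM lnM ?posrE// ?normr_gt0 ?gt_eqF//.
rewrite (ger0_norm (ltW q1)) addrAC subrr add0r.
set t := dotv delta x; pose y := c / (2 * k).
have : 0 <= qform s (delta - (y / (1 + q)) *: v) by exact: qform_ge0.
rewrite qformB qformZ -scalemxAr dotvZr Wv -/t (qformE s v) Wv -/q.
set Q := qform s delta => Qge.
apply: (@le_trans _ _ (c ^+ 2 / (4 * k) * (q / (1 + q)))); last first.
  apply: ler_wpM2l; last by apply: ln_ge_divD1; lra.
  by rewrite divr_ge0 ?sqr_ge0// ltW// mulr_gt0.
have -> : c ^+ 2 / (4 * k) * (q / (1 + q)) = k * (y ^+ 2 * (q / (1 + q))).
  by rewrite /y; field; rewrite !gt_eqF.
have -> : c = k * (2 * y) by rewrite /y; field; rewrite gt_eqF.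
rewrite -mulrA -mulrBr ler_pM2l//.
pose z := y / (1 + q).
have yz : y = z * (1 + q) by rewrite /z; field; rewrite gt_eqF.
have -> : y ^+ 2 * (q / (1 + q)) = z ^+ 2 * q * (1 + q).
  by rewrite /z; field; rewrite gt_eqF.
move: Qge; rewrite -/z yz.
have : 0 <= (t - z * q) ^+ 2 by exact: sqr_ge0.
lra.
Qed.

(* Comparing the maximum with the value at the midpoint of a and b avoids the
   first-order condition at a. *)
Lemma Phi_max_gap s a b C : is_Phi_max s a -> Phi_dom s b ->
  (forall x, x \in s -> 1 + dotv a x <= C) ->
  (forall x, x \in s -> 1 + dotv b x <= C) ->
  Phi s b <= Phi s a - qform s (b - a) / (4 * C ^+ 2).
Proof.
move=> [aD amax] bD aC bC.
pose m := 2^-1 *: (a + b).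
have mE x : 1 + dotv m x = ((1 + dotv a x) + (1 + dotv b x)) / 2.
  by rewrite /m dotvZl dotvDl; field.
have mD : Phi_dom s m.
  by move=> x xs; rewrite mE; have := aD x xs; have := bD x xs; lra.
have := amax _ mD.
suff : (Phi s a + Phi s b) / 2 + qform s (b - a) / (8 * C ^+ 2) <= Phi s m.
  have -> : qform s (b - a) / (4 * C ^+ 2) = 2 * (qform s (b - a) / (8 * C ^+ 2)).
    by rewrite !invfM; move: (C ^+ 2)^-1 => w; lra.
  lra.
rewrite /Phi /qform -big_split/= !mulr_suml -big_split/= !big_seq.
apply: ler_sum => x xs; rewrite dotvBl mE.
have -> : dotv b x - dotv a x = (1 + dotv b x) - (1 + dotv a x) by ring.
by apply: ln_midpoint; rewrite ?aC ?bC ?aD ?bD.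
Qed.

(** The old terms lose [qform s (b - a) / (4 * C ^+ 2)] because [a] is their maximizer. The new term
    gains a linear part in [b - a] minus a square with the same constant, which completes the
    quadratic form to [rcons s x]. The sum is then an instance of [quadratic_le_det_increment]. *)
Lemma Phi_increment_le s x a b C e : is_Phi_max s a ->
  Phi_dom (rcons s x) b -> gram s \in unitmx -> 0 < e <= 1 + dotv a x ->
  (forall y, y \in rcons s x -> 1 + dotv a y <= C) ->
  (forall y, y \in rcons s x -> 1 + dotv b y <= C) ->
  Phi (rcons s x) b - Phi (rcons s x) a <=
  (C / e) ^+ 2 * (ln `|\det (gram (rcons s x))| - ln `|\det (gram s)|).
Proof.
move=> amax bD Wu /andP[e0 ea] aC bC.
have xr : x \in rcons s x by rewrite mem_rcons mem_head.
have sr y : y \in s -> y \in rcons s x by rewrite mem_rcons inE orbC => ->.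
have u0 : 0 < 1 + dotv a x by exact: lt_le_trans ea.
have C0 : 0 < C by exact: lt_le_trans (aC _ xr).
have gap : Phi s b <= Phi s a - qform s (b - a) / (4 * C ^+ 2).
  by apply: Phi_max_gap => // y /sr ys; [exact: bD | exact: aC | exact: bC].
have := @ln_le_tangent R C (1 + dotv a x) (1 + dotv b x).
rewrite u0 aC// bC// bD// => /(_ isT isT).
have -> : 1 + dotv b x - (1 + dotv a x) = dotv (b - a) x by rewrite dotvBl; ring.
move=> tangent; set u := 1 + dotv a x in ea u0 tangent *.
have k0 : 0 < (4 * C ^+ 2)^-1 by rewrite invr_gt0 mulr_gt0 ?exprn_gt0.
have := quadratic_le_det_increment x (b - a) u^-1 k0 Wu.
set L := ln _ - ln _ => quad.
(* The sign of [L] is what allows [u] to be replaced by its lower bound [e] in the coefficient. *)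
have L0 : 0 <= L.
  rewrite /L gram_rcons det_rank1_update// normrM lnM ?posrE ?normr_gt0 -?unitfE -?unitmxE//.
    rewrite addrAC subrr add0r ln_ge0// ger0_norm ?lerDl ?dotv_invmx_gram_ge0//.
    by rewrite addr_ge0// dotv_invmx_gram_ge0.
  by rewrite unitfE gt_eqF// ltr_pwDl// dotv_invmx_gram_ge0.
have cE : u^-1 ^+ 2 / (4 * (4 * C ^+ 2)^-1) = (C / u) ^+ 2.
  by field; rewrite !gt_eqF.
rewrite cE qform_rcons in quad.
have uL : (C / u) ^+ 2 * L <= (C / e) ^+ 2 * L.
  apply: ler_wpM2r => //; apply: lerXn2r; rewrite ?nnegrE.
  - by rewrite divr_ge0 ?ltW.
  - by rewrite divr_ge0 ?ltW.
  - by rewrite ler_pM2l// lef_pV2 ?posrE.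
rewrite !Phi_rcons -/u; nra.
Qed.

(** Each vector contributes at most |x_i| |x_j| <= (x_i^2 + x_j^2) / 2, which its squared norm
    dominates. *)
Lemma normr_gram_le s i j : `|gram s i j| <= \tr (gram s).
Proof.
have WE i' j' : gram s i' j' = \sum_(x <- s) x i' 0 * x j' 0.
  by rewrite summxE; apply: eq_bigr => x _; rewrite !mxE big_ord1 !mxE.
rewrite /mxtrace (eq_bigr (fun l => \sum_(x <- s) x l 0 * x l 0)) => [|l _]//.
rewrite WE exchange_big/=; apply: le_trans (ler_norm_sum _ _ _) _.
apply: ler_sum => x _.
have sq (m : 'I_d) : x m 0 ^+ 2 <= \sum_(l < d) x l 0 * x l 0.
  rewrite (bigD1 m)//= -expr2 lerDl sumr_ge0// => l _.
  by rewrite -expr2 sqr_ge0.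
have := sq i; have := sq j; rewrite normrM -(real_normK (num_real (x i 0))).
rewrite -(real_normK (num_real (x j 0))).
have : 0 <= (`|x i 0| - `|x j 0|) ^+ 2 by exact: sqr_ge0.
nra.
Qed.

(** The Leibniz expansion has d! terms, each a product of d entries. Such a crude bound suffices
    because only its logarithm is used. *)
Lemma normr_det_gram_le s : `|\det (gram s)| <= d`!%:R * \tr (gram s) ^+ d.
Proof.
apply: le_trans (ler_norm_sum _ _ _) _.
rewrite -perm.card_Sn mulr_natl -sumr_const; apply: ler_sum => p _.
rewrite normrM normrX normrN1 expr1n mul1r normr_prod -[X in _ <= _ ^+ X]card_ord.
rewrite -prodr_const.
by apply: ler_prod => i _; rewrite normr_ge0 normr_gram_le.
Qed.

End Regret.

(** * Finite limsup as an eventual upper bound *)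

Section Limsup.
Variable R : realType.
Implicit Types (u : nat -> R) (M : R).

Lemma limn_esup_ltyP u :
  (limn_esup (fun n => (u n)%:E) < +oo)%E <->
  exists M N, forall n, (N <= n)%N -> u n <= M.
Proof.
rewrite /limn_esup limf_esupE; split.
  move=> /ereal_inf_lt[_ /= [V [N _ NV] <-] supV].
  have ub n : (N <= n)%N -> ((u n)%:E <= ereal_sup [set (u k)%:E | k in V])%E.
    by move=> Nn; apply: ereal_sup_ubound; exists n => //; exact: NV.
  move: supV ub; case: ereal_sup => [M|//|] _ ub.
    by exists M, N => n /ub; rewrite lee_fin.
  (* The supremum dominates the real number [u N], hence is not -oo. *)
  by have := ub N (leqnn N); rewrite leeNy_eq.
move=> [M [N uM]]; apply: (@le_lt_trans _ _ M%:E); last exact: ltry.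
apply: (@le_trans _ _ (ereal_sup [set (u n)%:E | n in [set k | (N <= k)%N]])).
  by apply: ereal_inf_lbound; exists [set k | (N <= k)%N] => //; exists N.
by apply: ge_ereal_sup => _ /= [n Nn <-]; rewrite lee_fin uM.
Qed.

End Limsup.

(** * Consequences of admissibility, and existence of the maximizer *)

Section Admissible.
Variables (R : realType) (d : nat).
Implicit Types (a b x : 'cV[R]_d) (s p : seq 'cV[R]_d) (D : set 'cV[R]_d).

Lemma normr_dotv_le a x : `|dotv a x| <= enorm a * enorm x.
Proof.
rewrite -sqrtr_sqr /enorm -sqrtrM ?dotvv_ge0//.
exact/ler_wsqrtr/sqr_dotv_le.
Qed.

Lemma enorm_le_coord x (B : R) : (forall i, `|x i 0| <= B) ->
  enorm x <= Num.sqrt (d%:R * B ^+ 2).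
Proof.
move=> xB; apply: ler_wsqrtr; rewrite mulr_natl -[X in _ *+ X]card_ord -sumr_const.
apply: ler_sum => i _; rewrite -expr2 -(real_normK (num_real _)).
by rewrite lerXn2r ?nnegrE ?(le_trans _ (xB i)).
Qed.

(** A half-space is convex, so it contains the hull as soon as it contains [D]. *)
Lemma convex_hull_halfspace D a (r : R) :
  (forall x, D x -> r <= dotv a x) -> forall y, convex_hull D y -> r <= dotv a y.
Proof.
move=> Dr y hy; apply: (hy [set z | r <= dotv a z]); split => // u v l.
rewrite !inE/= => ur vr.
rewrite -[conv _ _ _]/(l%:num *: u + (1 - l%:num) *: v) [dotv a _]dotvC.
rewrite dotvDl !dotvZl (dotvC u) (dotvC v).
have : 0 <= l%:num by [].
have : l%:num <= 1 by [].
nra.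
Qed.

Lemma convex_hull_box D : interior (convex_hull D) 0 ->
  exists2 r : R, 0 < r & forall x, (forall i, `|x i 0| < r) -> convex_hull D x.
Proof.
move=> /nbhs_ballP[r /= r0 rD]; exists r => // x xr; apply: rD.
by split => // i j; rewrite /ball/= ord1 mxE sub0r normrN.
Qed.

Lemma compact_enorm_bounded D : compact D ->
  exists2 B : R, 0 < B & forall x, D x -> enorm x <= B.
Proof.
move=> /compact_bounded[M [_ DM]].
exists (Num.sqrt (d%:R * (M + 1) ^+ 2) + 1) => [|x Dx].
  by rewrite ltr_wpDl// sqrtr_ge0.
rewrite ler_wpDr//; apply: enorm_le_coord => i.
have M1 : M < M + 1 by rewrite ltrDl.
apply: le_trans (DM _ M1 x Dx); rewrite [leRHS]/Num.norm/= mx_normrE.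
exact: (@le_bigmax _ _ _ _ (fun ij => `|x ij.1 ij.2|) (i, ord0)).
Qed.

Lemma seq_enorm_bounded s : exists2 B : R, 0 < B & forall x, x \in s -> enorm x <= B.
Proof.
exists (1 + \sum_(x <- s) enorm x) => [|x xs].
  by rewrite ltr_pwDl// sumr_ge0// => x _; exact: enorm_ge0.
rewrite (big_rem x)//= addrCA lerDl addr_ge0// sumr_ge0// => y _.
exact: enorm_ge0.
Qed.

(** The product, unlike the sum of logarithms, is continuous up to the boundary of the region, so
    the extreme value theorem applies to it. *)
Lemma Phi_ln_prod s a : Phi_dom s a -> Phi s a = ln (\prod_(x <- s) (1 + dotv a x)).
Proof.
rewrite /Phi; elim: s => [|x s IH] sa; first by rewrite !big_nil ln1.
have sa' : Phi_dom s a by move=> y ys; apply: sa; rewrite inE ys orbT.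
rewrite !big_cons IH// lnM// posrE; first by rewrite sa// mem_head.
by rewrite big_seq prodr_gt0.
Qed.

Lemma continuous_prodr (T : topologicalType) (I : Type) (r : seq I) (F : I -> T -> R) :
  (forall i, continuous (F i)) -> continuous (fun v => \prod_(i <- r) F i v).
Proof.
move=> cF; elim: r => [|i r IH] v.
  by under eq_fun do rewrite big_nil; exact: cvg_cst.
by under eq_fun do rewrite big_cons; apply: cvgM; [exact: cF | exact: IH].
Qed.

Lemma continuous_sumr (T : topologicalType) (I : Type) (r : seq I) (F : I -> T -> R) :
  (forall i, continuous (F i)) -> continuous (fun v => \sum_(i <- r) F i v).
Proof.
move=> cF; elim: r => [|i r IH] v.
  by under eq_fun do rewrite big_nil; exact: cvg_cst.
by under eq_fun do rewrite big_cons; apply: cvgD; [exact: cF | exact: IH].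
Qed.

Lemma continuous_dotv_tr x : continuous (fun v : 'rV[R]_d => dotv v^T x).
Proof.
apply: continuous_sumr => i v.
under eq_fun do rewrite mxE.
exact: (cvgMr_tmp (@coord_continuous R 1 d 0 i v)).
Qed.

Lemma coord_le_enorm a i : `|a i 0| <= enorm a.
Proof.
rewrite -sqrtr_sqr; apply: ler_wsqrtr; rewrite /dotv (bigD1 i)//= -expr2 lerDl.
by rewrite sumr_ge0// => j _; rewrite -expr2 sqr_ge0.
Qed.

(* The hull contains the multiple of - a of norm r / 2, on which 1 + a . y >= eps
   also holds, so that |a| <= 2 / r. *)
Lemma admissible_bounded D (eps : R) s : interior (convex_hull D) 0 -> 0 < eps ->
  admissible_training D eps s ->
  exists2 M : R, 0 < M &
    forall a, (forall x, x \in s -> 0 <= 1 + dotv a x) -> enorm a <= M.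
Proof.
move=> /convex_hull_box[r r0 rD] eps0 [_ adm]; exists (2 / r) => [|a sa].
  by rewrite divr_gt0.
have [->|a0] := eqVneq (enorm a) 0; first by rewrite divr_ge0// ltW.
have ap : 0 < enorm a by rewrite lt_neqAle eq_sym a0 enorm_ge0.
pose y := (- (r / (2 * enorm a))) *: a.
have yD : convex_hull D y.
  have k0 : 0 < r / (2 * enorm a) by rewrite divr_gt0 ?mulr_gt0.
  apply: rD => i; rewrite mxE normrM normrN (gtr0_norm k0).
  rewrite mulrAC ltr_pdivrMr ?mulr_gt0// ltr_pM2l//.
  by have := coord_le_enorm a i; lra.
have : eps - 1 <= dotv a y.
  by apply: convex_hull_halfspace yD => x Dx; have := adm a sa x Dx; lra.
rewrite dotvZr -sqr_enorm.
have -> : - (r / (2 * enorm a)) * enorm a ^+ 2 = - (r * enorm a / 2) by field.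
by rewrite ler_pdivlMr//; lra.
Qed.

(** A null vector of the Gram matrix is orthogonal to all training vectors, so all its multiples
    satisfy the constraints, against [admissible_bounded]. *)
Lemma gram_unit D (eps : R) s : interior (convex_hull D) 0 -> 0 < eps ->
  admissible_training D eps s -> gram s \in unitmx.
Proof.
move=> D0 eps0 adm; have [M M0 bd] := admissible_bounded D0 eps0 adm.
rewrite unitmxE unitfE; apply/negP => /det0P[v v0 vW].
have : qform s v^T = 0.
  by rewrite qformE dotvE mulmxA trmxK vW mul0mx mxE.
move=> /eqP; rewrite psumr_eq0 => [/allP q0|x _]; last exact: sqr_ge0.
have dv0 x : x \in s -> dotv v^T x = 0.
  by move=> /q0; rewrite sqrf_eq0 => /eqP.
suff : enorm v^T = 0.
  move=> e0; move/eqP: v0; apply; apply/matrixP => i j; rewrite ord1 mxE.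
  have := coord_le_enorm v^T j.
  by rewrite e0 normr_le0 mxE => /eqP.
apply/eqP; apply: contraT => e0.
have ep : 0 < enorm v^T by rewrite lt_neqAle eq_sym e0 enorm_ge0.
have tM (t : R) : enorm (t *: v^T) <= M.
  by apply: bd => x /dv0 vx; rewrite dotvZl vx mulr0 addr0.
(* This multiple has norm 2 M. *)
have := tM (2 * M / enorm v^T).
rewrite /enorm dotvZl dotvZr mulrA -expr2 sqrtrM ?sqr_ge0// sqrtr_sqr -/(enorm _).
rewrite ger0_norm; last by rewrite divr_ge0 ?mulr_ge0 ?ltW.
rewrite divfK//; lra.
Qed.

(** Admissibility keeps the factor of every move in [D] at least [eps], so such moves do not shrink
    the domain. *)
Lemma Phi_dom_admissible D (eps : R) s p a : 0 < eps ->
  admissible_training D eps s -> (forall x, x \in p -> D x) ->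
  Phi_dom s a -> Phi_dom (s ++ p) a.
Proof.
move=> eps0 [_ adm] pD sa x; rewrite mem_cat => /orP[|/pD xD]; first exact: sa.
by apply: lt_le_trans eps0 (adm a _ x xD) => y /sa/ltW.
Qed.

(* A maximizer of the product over the closed region is positive on every factor,
   because the product is 1 at the origin. *)
Lemma exists_Phi_max D (eps : R) s p : interior (convex_hull D) 0 -> 0 < eps ->
  admissible_training D eps s -> (forall x, x \in p -> D x) ->
  exists a, is_Phi_max (s ++ p) a.
Proof.
move=> D0 eps0 adm pD; have [M M0 bd] := admissible_bounded D0 eps0 adm.
pose A : set 'rV[R]_d := [set v | forall x, x \in s -> 0 <= 1 + dotv v^T x].
pose f (v : 'rV[R]_d) := \prod_(x <- s ++ p) (1 + dotv v^T x).
have c1 x : continuous (fun v : 'rV[R]_d => 1 + dotv v^T x).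
  by move=> v; exact: (cvgD (cvg_cst _) (@continuous_dotv_tr x v)).
have cA : compact A.
  apply: bounded_closed_compact.
    exists M; split; first exact: num_real.
    move=> N MN v /bd vM; apply: le_trans (ltW MN).
    rewrite [leLHS]/Num.norm/= mx_normrE; apply/bigmax_leP; split => [|[i j] _ /=].
      exact: ltW.
    apply: le_trans vM; have := coord_le_enorm v^T j.
    by rewrite mxE ord1.
  rewrite (_ : A = \bigcap_(x in [set x | x \in s])
      (fun v : 'rV[R]_d => 1 + dotv v^T x) @^-1` [set t | 0 <= t])%classic//.
  apply: closed_bigI => x _; apply: preimage_closed; last exact: closed_ge.
  by move=> v _; exact: c1.
have A0 : A 0 by move=> x _; rewrite trmx0 dotv0l addr0.
have cf : {within A, continuous f}.
  by apply: continuous_subspaceT; exact: continuous_prodr.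
have [v vA vmax] := compact_EVT_max (ex_intro _ _ A0) cA cf.
have {}vA : A v by rewrite inE in vA.
have fv1 : 1 <= f v.
  apply: le_trans (vmax 0 _); last by rewrite inE.
  by rewrite /f big1// => x _; rewrite trmx0 dotv0l addr0.
have vD : Phi_dom (s ++ p) v^T.
  apply: (Phi_dom_admissible eps0 adm pD) => x xs; rewrite lt_neqAle vA// andbT.
  apply/eqP => v0; move: fv1; rewrite /f (big_rem x)/=; last by rewrite mem_cat xs.
  by rewrite -v0 mul0r ler10.
exists v^T; split => // b bD; rewrite !Phi_ln_prod// ler_ln ?posrE.
- have := vmax b^T; rewrite /f trmxK; apply; rewrite inE => x xs.
  by rewrite trmxK ltW// bD// mem_cat xs.
- by rewrite big_seq prodr_gt0.
- by rewrite big_seq prodr_gt0.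
Qed.

Lemma sos_is_Phi_max D (eps : R) s p : interior (convex_hull D) 0 -> 0 < eps ->
  admissible_training D eps s -> (forall x, x \in p -> D x) ->
  is_Phi_max (s ++ p) (sos s p).
Proof. by move=> D0 e0 adm pD; have /(xgetPex 0) := exists_Phi_max D0 e0 adm pD. Qed.

End Admissible.

(** * Optimization over the size of the test point *)

Section Growth.
Variable R : realType.
Implicit Types A B S T w rho mu : R.

(* Take [mu = rho * sqrt (ln T / T)] when [T >= e] and [mu = rho] otherwise. *)
Lemma growth_bound A B w rho : 0 <= A -> 0 <= B -> 1 <= w -> 0 < rho ->
  exists K, forall S T, 0 <= T ->
    (forall mu, 0 <= mu <= rho -> mu * S - 2 * mu ^+ 2 * T <= A + B * ln (T + w)) ->
    S <= K * Num.sqrt (Num.max 1 (T * ln T)).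
Proof.
move=> A0 B0 w1 r0.
pose e : R := expR 1.
have e1 : 1 < e by rewrite expR_gt1.
(* [K1] serves the range [T >= e] and [K2] the range [T < e]. *)
pose K1 := (A + B * (1 + ln (1 + w)) + 2 * rho ^+ 2) / rho.
pose K2 := (A + B * ln (e + w) + 2 * rho ^+ 2 * e) / rho.
have lw0 : 0 <= ln (1 + w) by rewrite ln_ge0//; lra.
have lew0 : 0 <= ln (e + w) by rewrite ln_ge0//; lra.
have r2 : 0 <= rho ^+ 2 by exact: sqr_ge0.
have K10 : 0 <= K1.
  apply: divr_ge0 (ltW r0).
  have : 0 <= B * (1 + ln (1 + w)) by rewrite mulr_ge0 ?addr_ge0.
  lra.
have K20 : 0 <= K2.
  apply: divr_ge0 (ltW r0).
  have : 0 <= B * ln (e + w) by rewrite mulr_ge0.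
  have : 0 <= rho ^+ 2 * e by rewrite mulr_ge0// expR_ge0.
  lra.
exists (K1 + K2) => S T T0 bd.
set G := Num.sqrt _.
have G1 : 1 <= G by rewrite -[leLHS]sqrtr1 ler_wsqrtr// le_max lexx.
have [Te|eT] := ltP T e.
  suff : S <= K2 by have : 0 <= K1 * G; [rewrite mulr_ge0//|]; nra.
  rewrite ler_pdivlMr// mulrC.
  have := bd rho; rewrite lexx (ltW r0) => /(_ isT).
  have : ln (T + w) <= ln (e + w) by rewrite ler_ln ?posrE; lra.
  by move=> /(ler_wpM2l B0); nra.
have Tp : 0 < T by lra.
have L1 : 1 <= ln T by rewrite -ler_expR lnK ?posrE.
have LT : ln T <= T by rewrite ltW// ln_sublinear.
(* Here T + w <= T (1 + w), and [1 <= ln T] absorbs the constant. *)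
have lTw : ln (T + w) <= (1 + ln (1 + w)) * ln T.
  have : ln (T + w) <= ln T + ln (1 + w).
    by rewrite -lnM ?posrE ?ler_ln ?posrE ?mulr_gt0//; nra.
  nra.
pose l := Num.sqrt (ln T); pose t := Num.sqrt T.
have l2 : l ^+ 2 = ln T by rewrite sqr_sqrtr//; lra.
have t2 : t ^+ 2 = T by rewrite sqr_sqrtr.
have lp : 0 < l by rewrite sqrtr_gt0; lra.
have tp : 0 < t by rewrite sqrtr_gt0.
have lt : l <= t by rewrite ler_wsqrtr.
have GE : l * t <= G.
  rewrite -sqrtrM; last by lra.
  by rewrite ler_wsqrtr// le_max (mulrC T) lexx orbT.
have := bd (rho * l / t).
have -> : 0 <= rho * l / t <= rho.
  apply/andP; split; last by rewrite ler_pdivrMr// ler_pM2l.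
  exact: divr_ge0 (mulr_ge0 (ltW r0) (ltW lp)) (ltW tp).
move=> /(_ isT).
have -> : 2 * (rho * l / t) ^+ 2 * T = 2 * rho ^+ 2 * ln T.
  by rewrite -{1}t2 -l2; field; rewrite gt_eqF.
move=> h.
(* For this choice of mu, every term on the right is at most a constant times [ln T]; dividing by mu
   turns this into [K1 * (l * t)]. *)
have {}h : rho * l / t * S <= K1 * rho * l ^+ 2.
  rewrite divfK ?gt_eqF// l2.
  have := ler_wpM2l B0 lTw; have : A <= A * ln T by nra.
  lra.
have : S <= K1 * (l * t).
  rewrite -(@ler_pM2l _ (rho * l / t)); last by rewrite divr_gt0 ?mulr_gt0.
  apply: le_trans h _; rewrite le_eqVlt; apply/orP; left; apply/eqP.
  by field; rewrite gt_eqF.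
have : K1 * (l * t) <= K1 * G by rewrite ler_wpM2l.
have : 0 <= K2 * G by rewrite mulr_ge0//; lra.
lra.
Qed.

End Growth.

(** * The sequential optimizing strategy along a fixed path *)

Section Strategy.
Variables (R : realType) (d : nat) (D : set 'cV[R]_d) (eps : R).
Variables (s : seq 'cV[R]_d) (xi : nat -> 'cV[R]_d).
Hypothesis D0 : interior (convex_hull D) 0.
Hypothesis Dc : compact D.
Hypothesis eps0 : 0 < eps.
Hypothesis adm : admissible_training D eps s.
Hypothesis xiD : forall n, D (xi n).

Local Notation moves n := (s ++ mkseq xi n).
Local Notation alpha n := (sos s (mkseq xi n)).

Lemma mkseq_in n x : x \in mkseq xi n -> D x.
Proof. by move=> /mapP[k _ ->]. Qed.

Lemma moves_rcons n : moves n.+1 = rcons (moves n) (xi n).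
Proof. by rewrite mkseqS rcons_cat. Qed.

Lemma alpha_max n : is_Phi_max (moves n) (alpha n).
Proof. by apply: (sos_is_Phi_max D0 eps0 adm) => x /mkseq_in. Qed.

Lemma alpha_dom n : Phi_dom s (alpha n).
Proof. by have [aD _] := alpha_max n => x xs; apply: aD; rewrite mem_cat xs. Qed.

Lemma alpha_dom_moves n m : Phi_dom (moves m) (alpha n).
Proof.
apply: (Phi_dom_admissible eps0 adm) => [x /mkseq_in//|]; exact: alpha_dom.
Qed.

Lemma alpha_xi_ge n m : eps <= 1 + dotv (alpha n) (xi m).
Proof. by apply: adm.2 => // x xs; apply/ltW/alpha_dom. Qed.

Lemma moves_enorm_bounded :
  exists2 B : R, 0 < B & forall n x, x \in moves n -> enorm x <= B.
Proof.
have [B1 B10 sB] := seq_enorm_bounded s.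
have [B2 B20 DB] := compact_enorm_bounded Dc.
exists (B1 + B2) => [|n x]; first by rewrite addr_gt0.
rewrite mem_cat => /orP[/sB|/mkseq_in/DB]; lra.
Qed.

Lemma gram_moves_unit n : gram (moves n) \in unitmx.
Proof.
elim: n => [|n IH]; first by rewrite cats0 (gram_unit D0 eps0 adm).
by rewrite moves_rcons gram_rcons_unit.
Qed.

Lemma capital_sos_gt0 n : 0 < capital (sos s) xi n.
Proof.
by apply: prodr_gt0 => k _; apply: lt_le_trans eps0 (alpha_xi_ge k k).
Qed.

(** By induction on the number of rounds: moving from [alpha n] to [alpha n.+1] costs at most one
    determinant increment, by [Phi_increment_le]. *)
Lemma ln_capital_ge : exists2 c : R, 0 <= c & forall n,
  Phi (moves n) (alpha n) - Phi s (alpha 0)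
    - c * (ln `|\det (gram (moves n))| - ln `|\det (gram s)|)
  <= ln (capital (sos s) xi n).
Proof.
have [M M0 aM] := admissible_bounded D0 eps0 adm.
have [B B0 xB] := moves_enorm_bounded.
(* By Cauchy-Schwarz this bounds all factors, since [M] bounds the maximizers and [B] the
   vectors. *)
pose C := 1 + M * B.
have bound n m x : x \in moves m -> 1 + dotv (alpha n) x <= C.
  move=> xm; rewrite lerD2l; apply: le_trans (ler_norm _) _.
  apply: le_trans (normr_dotv_le _ _) _.
  apply: ler_pM; rewrite ?enorm_ge0 ?(xB m)//.
  by apply: aM => y ys; apply/ltW/alpha_dom.
exists ((C / eps) ^+ 2) => [|n]; first exact: sqr_ge0.
elim: n => [|n IH]; first by rewrite cats0 !subrr mulr0 subrr /capital big_ord0 ln1.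
have -> : ln (capital (sos s) xi n.+1) =
    ln (capital (sos s) xi n) + ln (1 + dotv (alpha n) (xi n)).
  rewrite /capital big_ord_recr/= lnM// posrE; first exact: capital_sos_gt0.
  exact: lt_le_trans eps0 (alpha_xi_ge n n).
have := @Phi_increment_le R d (moves n) (xi n) (alpha n) (alpha n.+1) C eps
  (alpha_max n).
rewrite -moves_rcons eps0 alpha_xi_ge gram_moves_unit.
move=> /(_ (@alpha_dom_moves n.+1 n.+1) isT isT (bound n n.+1) (bound n.+1 n.+1)).
rewrite {2}moves_rcons Phi_rcons.
lra.
Qed.

Lemma mxtrace_Vmx n : \tr (Vmx xi n) = \sum_(k < n) dotv (xi k) (xi k).
Proof.
rewrite /Vmx raddf_sum/=; apply: eq_bigr => k _.
by rewrite mxtrace_mulC trace_mx11 dotvE.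
Qed.

Lemma gram_moves n : gram (moves n) = gram s + Vmx xi n.
Proof.
elim: n => [|n IH]; first by rewrite cats0 /Vmx big_ord0 addr0.
by rewrite moves_rcons gram_rcons IH /Vmx big_ord_recr/= addrA.
Qed.

Lemma Phi_moves n b : Phi (moves n) b = Phi s b + \sum_(k < n) ln (1 + dotv b (xi k)).
Proof.
elim: n => [|n IH]; first by rewrite cats0 big_ord0 addr0.
by rewrite moves_rcons Phi_rcons IH big_ord_recr/= addrA.
Qed.

Lemma Phi_max_ge : exists2 rho : R, 0 < rho & forall n mu, 0 <= mu <= rho ->
  mu * enorm (psum xi n) - 2 * mu ^+ 2 * \tr (Vmx xi n) - (size s)%:R <=
  Phi (moves n) (alpha n).
Proof.
have [B B0 xB] := moves_enorm_bounded.
(* A test point of norm at most [(2 * B)^-1] has inner products at most 1/2 in absolute value, as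
   [ln_ge_sub_sqr] demands. *)
exists (2 * B)^-1 => [|n mu /andP[mu0 mur]]; first by rewrite invr_gt0 mulr_gt0.
(* When the sum of moves vanishes, [b] is 0 and the estimates below still hold. *)
set S := enorm _; pose b := (mu / S) *: psum xi n.
have S0 : 0 <= S by exact: enorm_ge0.
have bS : dotv b (psum xi n) = mu * S.
  rewrite dotvZl -sqr_enorm -/S.
  by have [->|Sn] := eqVneq S 0; [rewrite !(mulr0, expr0n)|field].
have bb : dotv b b <= mu ^+ 2.
  rewrite dotvZr bS.
  have [->|Sn] := eqVneq S 0; first by rewrite !mulr0 sqr_ge0.
  by have -> : mu / S * (mu * S) = mu ^+ 2 by field.
have bmu : enorm b <= mu.
  by rewrite -[leRHS](ger0_norm mu0) -sqrtr_sqr ler_wsqrtr.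
have bx x : x \in moves n -> `|dotv b x| <= 2^-1.
  move=> xn; apply: le_trans (normr_dotv_le _ _) _.
  apply: (@le_trans _ _ ((2 * B)^-1 * B)).
    by apply: ler_pM; rewrite ?enorm_ge0 ?(xB n)// (le_trans bmu).
  by rewrite invfM mulfVK ?gt_eqF.
have [_ amax] := alpha_max n.
apply: le_trans (amax b _); last first.
  by move=> x /bx; rewrite ler_norml; lra.
rewrite Phi_moves.
(* On |y| <= 1/2 the bound y - 2 y^2 is at least -1, so each training vector costs at most 1. *)
have sge : - (size s)%:R <= Phi s b.
  rewrite /Phi -sum1_size natr_sum -sumrN !big_seq; apply: ler_sum => x xs.
  have xn : x \in moves n by rewrite mem_cat xs.
  apply: le_trans (ln_ge_sub_sqr (bx x xn)).
  by have := bx x xn; rewrite ler_norml; nra.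
have : mu * S - 2 * mu ^+ 2 * \tr (Vmx xi n) <= \sum_(k < n) ln (1 + dotv b (xi k)).
  rewrite -bS dotv_sumr mxtrace_Vmx mulr_sumr -sumrB; apply: ler_sum => k _.
  have kn : xi k \in moves n by rewrite mem_cat orbC map_f ?mem_iota//=.
  apply: le_trans (ln_ge_sub_sqr (bx _ kn)).
  rewrite lerD2l lerN2 -mulrA ler_pM2l//.
  apply: le_trans (sqr_dotv_le _ _) _.
  by rewrite ler_wpM2r// dotvv_ge0.
lra.
Qed.

Lemma mxtrace_Vmx_ge0 n : 0 <= \tr (Vmx xi n).
Proof. by rewrite mxtrace_Vmx sumr_ge0// => k _; exact: dotvv_ge0. Qed.

Lemma mxtrace_gram_ge0 p : 0 <= \tr (gram p : 'M[R]_d).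
Proof.
rewrite /gram raddf_sum/= sumr_ge0// => x _.
by rewrite mxtrace_mulC trace_mx11 -dotvE dotvv_ge0.
Qed.

(** The added 1 keeps the argument of the logarithm positive and provides the shift [w] >= 1 of
    [growth_bound]. *)
Lemma ln_det_gram_moves_le n :
  ln `|\det (gram (moves n))| <=
  ln d`!%:R + d%:R * ln (\tr (Vmx xi n) + (\tr (gram s) + 1)).
Proof.
have T0 := mxtrace_Vmx_ge0 n; have w0 := mxtrace_gram_ge0 s.
have p : 0 < \tr (Vmx xi n) + (\tr (gram s) + 1) by lra.
have f0 : 0 < d`!%:R :> R by rewrite ltr0n fact_gt0.
rewrite mulr_natl -lnXn// -lnM ?posrE ?exprn_gt0// ler_ln ?posrE ?mulr_gt0 ?exprn_gt0//.
  apply: le_trans (normr_det_gram_le _) _; rewrite ler_pM2l//.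
  by rewrite gram_moves mxtraceD lerXn2r ?nnegrE; lra.
by rewrite normr_gt0 -unitfE -unitmxE gram_moves_unit.
Qed.

Lemma capital_bounded_growth M :
  exists K : R, forall n, capital (sos s) xi n <= M ->
    enorm (psum xi n) <=
      K * Num.sqrt (Num.max 1 (\tr (Vmx xi n) * ln (\tr (Vmx xi n)))).
Proof.
have [c c0 capge] := ln_capital_ge.
have [rho rho0 Phige] := Phi_max_ge.
(* [A0] collects the terms free of [n] and mu; [growth_bound] wants a nonnegative constant, hence
   its absolute value below. *)
pose A0 := ln M + Phi s (alpha 0) + (size s)%:R
  + c * (ln d`!%:R - ln `|\det (gram s)|).
have w1 : 1 <= \tr (gram s) + 1 by have := mxtrace_gram_ge0 s; lra.
have cd0 : 0 <= c * d%:R by rewrite mulr_ge0.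
have [K HK] := growth_bound (normr_ge0 A0) cd0 w1 rho0.
exists K => n capM; apply: HK => [|mu murho]; first exact: mxtrace_Vmx_ge0.
have capn0 := capital_sos_gt0 n.
have lncap : ln (capital (sos s) xi n) <= ln M.
  by rewrite ler_ln ?posrE//; exact: lt_le_trans capM.
have := capge n; have := Phige n mu murho.
have := ler_wpM2l c0 (ln_det_gram_moves_le n).
have : A0 <= `|A0| by exact: ler_norm.
rewrite {1}/A0; lra.
Qed.

End Strategy.

Theorem theorem2p1 (R : realType) (d : nat) (D : set 'cV[R]_d)
  (eps0 : R) (training : seq 'cV[R]_d)
  (hcompact : compact D)
  (hhull : interior (convex_hull D) 0)
  (heps0 : 0 < eps0 < 1)
  (htraining : admissible_training D eps0 training) :
  weakly_forces D (sos training) (@growth_event R d).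
Proof.
(* By contraposition: a capital whose limsup is not +oo is eventually bounded by some [M]. *)
move=> xi xiD; apply: contra_notP => capnoo.
have /limn_esup_ltyP[M [N capM]] :
    (limn_esup (fun n => (capital (sos training) xi n)%:E) < +oo)%E.
  by rewrite ltey; apply/eqP.
have /andP[e0 _] := heps0.
have [K HK] := capital_bounded_growth hhull hcompact e0 htraining xiD M.
apply/limn_esup_ltyP; exists K, N => n Nn.
rewrite ler_pdivrMr; first by apply: HK; exact: capM.
by rewrite sqrtr_gt0 lt_max ltr01.
Qed.
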